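(* Let $K_m$ and $K_n$ be complete graphs on $m$ and $n$ vertices with $n\ge m\ge 3$. Then ${\rm dmg}(K_m\square K_n)=m$.
   Context: The Cartesian product $G\square H$ has vertex set $V(G)\times V(H)$, with $(u,v)\sim(u',v')$ iff ($u=u'$ and $vv'\in E(H)$) or ($v=v'$ and $uu'\in E(G)$). Damage game on a graph: one cop and one robber; in round $0$ the cop chooses a vertex, then the robber does; in each later round the cop moves to an adjacent vertex or passes, then the robber moves to an adjacent vertex or passes; the robber is captured if the cop occupies the robber's vertex. A vertex $v$ is damaged if the robber occupies $v$ in some round $i\ge0$ and in round $i+1$ the uncaptured robber passes or moves to a neighbour. The damage number ${\rm dmg}(\cdot)$ is the number of distinct vertices damaged when the cop plays to minimize and the robber to maximize this number. *)

(* Defs.v *)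
From mathcomp Require Import all_boot.
From mathcomp Require Import boolp.
Set Implicit Arguments.
Unset Strict Implicit.
Unset Printing Implicit Defensive.

Record sgraph := SGraph {
  vertex :> finType;
  adj : rel vertex;
  adj_sym : symmetric adj;
  adj_irrefl : irreflexive adj }.

Section Graphs.

Definition complete_adj (n : nat) : rel 'I_n := fun u v => u != v.

Lemma complete_adj_sym n : symmetric (@complete_adj n).
Proof. by move=> u v; rewrite /complete_adj eq_sym. Qed.

Lemma complete_adj_irrefl n : irreflexive (@complete_adj n).
Proof. by move=> u; rewrite /complete_adj eqxx. Qed.

Definition complete_graph (n : nat) : sgraph :=
  SGraph (@complete_adj_sym n) (@complete_adj_irrefl n).

Variables G H : sgraph.

Definition box_adj : rel (G * H)%type := fun x y =>
  ((x.1 == y.1) && adj x.2 y.2) || ((x.2 == y.2) && adj x.1 y.1).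

Lemma box_adj_sym : symmetric box_adj.
Proof.
move=> x y; rewrite /box_adj [x.1 == _]eq_sym [x.2 == _]eq_sym.
by rewrite [adj x.2 _]adj_sym [adj x.1 _]adj_sym.
Qed.

Lemma box_adj_irrefl : irreflexive box_adj.
Proof. by move=> x; rewrite /box_adj !adj_irrefl !andbF. Qed.

Definition cartesian_product : sgraph := SGraph box_adj_sym box_adj_irrefl.

End Graphs.

Section DamageGame.

Variable G : sgraph.

Definition pass_or_move (u v : G) : bool := (u == v) || adj u v.

(* A position is the pair (cop's vertex, robber's vertex) at the end of a
   round. In the strategies below, [h] lists the positions of the earlier
   rounds in chronological order and [p] is the position at the end of the
   latest round: both players have perfect information and memory. *)
Definition position : Type := (G * G)%type.

Record cop_strategy := CopStrategy {
  cop_start : G;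
  cop_move : seq position -> position -> G;
  cop_legal : forall h p, pass_or_move p.1 (cop_move h p) }.

(* The robber also sees the cop's choice [c] in the current round. *)
Record robber_strategy := RobberStrategy {
  robber_start : G -> G;
  robber_move : seq position -> position -> G -> G;
  robber_legal : forall h p c, pass_or_move p.2 (robber_move h p c) }.

Section Play.

Variables (s : cop_strategy) (r : robber_strategy).

Fixpoint play (i : nat) : seq position * position :=
  if i is j.+1 then
    let: (h, p) := play j in
    let c := cop_move s h p in
    (rcons h p, (c, robber_move r h p c))
  else ([::], (cop_start s, robber_start r (cop_start s))).

Definition cop_at (i : nat) : G := (play i).2.1.
Definition robber_at (i : nat) : G := (play i).2.2.

(* The robber is still uncaptured when his turn of round [i.+1] comes: up to
   then the cop was never on the robber's vertex, neither at the end of a round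
   [j] nor right after the cop's turn of round [j.+1]. The moves that [play]
   prescribes after a capture are thus irrelevant. *)
Definition uncaptured_at_turn (i : nat) : Prop :=
  forall j, j <= i ->
    cop_at j != robber_at j /\ cop_at j.+1 != robber_at j.

Definition damaged (v : G) : Prop :=
  exists i, robber_at i = v /\ uncaptured_at_turn i.

Definition damage : nat := #|[set v : G | `[< damaged v >]]|.

End Play.

(* Every damage is at most #|G|, so the bounded ranges below cover all the
   values attained: these are the maximum over all robber strategies and the
   minimum over all cop strategies. *)
Definition max_damage (s : cop_strategy) : nat :=
  \max_(k < #|G|.+1 | `[< exists r : robber_strategy, damage s r = k >]) k.

Definition dmg : nat :=
  \big[minn/#|G|]_(k < #|G|.+1 |
    `[< exists s : cop_strategy, max_damage s = k >]) k.

End DamageGame.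

(* Main.v *)
Require Import Defs.
From mathcomp Require Import all_boot.
From mathcomp Require Import boolp zify.
Set Implicit Arguments.
Unset Strict Implicit.
Unset Printing Implicit Defensive.

(* The graph is the m x n rook's graph.
   Upper bound: the cop captures an adjacent robber and otherwise moves, inside
   his own column, to the robber's row.  A robber who stays in that row is then
   captured, so he never leaves the column he started from, which has m cells.
   Lower bound: the robber always moves to an unvisited cell that shares no line
   with the cop.  If the cop has just moved to the robber's row, every other
   cell of the robber's column is available; if he has moved to the robber's
   column, every other cell of the robber's row is; if he is on neither, all
   but two of the m + n - 1 cells of both lines are.  With the cell he occupies,
   this makes at least min(m, n, m + n - 3) = m cells, so the robber is not
   stuck before he has visited m of them. *)

Lemma bigminn_leq (I : eqType) x (e : seq I) (P : pred I) (F : I -> nat) j :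
  j \in e -> P j -> \big[minn/x]_(i <- e | P i) F i <= F j.
Proof.
elim: e => [//|i e IHe]; rewrite inE big_cons => /orP[/eqP<- ->|je Pj].
  exact: geq_minl.
by case: ifP => _; rewrite ?geq_min IHe ?orbT.
Qed.

(** * Strategies and the damage number in an arbitrary graph *)

Section DamageBounds.

Variable G : sgraph.

Lemma damage_le_card (s : cop_strategy G) r : damage s r <= #|G|.
Proof. exact: max_card. Qed.

Lemma damage_le_max_damage (s : cop_strategy G) r : damage s r <= max_damage s.
Proof.
have lt_d : damage s r < #|G|.+1 by rewrite ltnS damage_le_card.
apply: (@bigmax_sup _ (Ordinal lt_d)) => //.
by apply/asboolP; exists r.
Qed.

Lemma max_damage_leq (s : cop_strategy G) k :
  (forall r, damage s r <= k) -> max_damage s <= k.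
Proof. by move=> le_k; apply/bigmax_leqP => i /asboolP[r <-]. Qed.

Lemma dmg_leq (s : cop_strategy G) : dmg G <= max_damage s.
Proof.
have lt_d : max_damage s < #|G|.+1.
  by rewrite ltnS; apply: max_damage_leq => r; apply: damage_le_card.
apply: (@bigminn_leq _ _ _ _ _ (Ordinal lt_d)); first exact: mem_index_enum.
by apply/asboolP; exists s.
Qed.

(** The bound on [#|G|] is for the default value of the minimum in [dmg]. *)
Lemma leq_dmg k :
  k <= #|G| -> (forall s : cop_strategy G, k <= max_damage s) -> k <= dmg G.
Proof.
move=> le_kG le_k; rewrite /dmg; elim/big_ind: _ => [//|x y kx ky|i].
  by rewrite leq_min kx.
by move=> /asboolP[s <-].
Qed.

Lemma pass_or_move_refl (u : G) : pass_or_move u u.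
Proof. by rewrite /pass_or_move eqxx. Qed.

Variables (s : cop_strategy G) (r : robber_strategy G).

(** Used to recognise the list of visited cells that the robber reads off his history. *)
Lemma play_history i :
  rcons (play s r i).1 (play s r i).2 = [seq (play s r j).2 | j <- iota 0 i.+1].
Proof.
elim: i => [//|i IHi]; rewrite -[i.+2]addn1 iotaD map_cat -IHi cats1 /=.
by case: (play s r i).
Qed.

Lemma cop_atS i :
  cop_at s r i.+1 = cop_move s (play s r i).1 (cop_at s r i, robber_at s r i).
Proof. by rewrite /cop_at /robber_at /=; case: (play s r i) => h []. Qed.

Lemma robber_atS i :
  robber_at s r i.+1 =
  robber_move r (play s r i).1 (cop_at s r i, robber_at s r i)
    (cop_at s r i.+1).
Proof. by rewrite /cop_at /robber_at /=; case: (play s r i) => h []. Qed.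

Lemma cop_step i : pass_or_move (cop_at s r i) (cop_at s r i.+1).
Proof.
by rewrite cop_atS (cop_legal s _ (cop_at s r i, robber_at s r i)).
Qed.

Lemma robber_step i : pass_or_move (robber_at s r i) (robber_at s r i.+1).
Proof.
by rewrite robber_atS (robber_legal r _ (cop_at s r i, robber_at s r i)).
Qed.

End DamageBounds.

Section RookGraph.

Variables m n : nat.

Let G := cartesian_product (complete_graph m) (complete_graph n).

Lemma rook_pass_or_move (u v : G) :
  pass_or_move u v = (u.1 == v.1) || (u.2 == v.2).
Proof.
case: u v => [a b] [c d].
rewrite /pass_or_move /adj /= /box_adj /= /complete_adj xpair_eqE.
by case: (a == c); case: (b == d).
Qed.

(** * Upper bound: the cop who follows the robber's row *)

Definition cop_shadow_move (p : position G) : G :=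
  if pass_or_move p.1 p.2 then p.2 else (p.2.1, p.1.2).

Lemma cop_shadow_legal (h : seq (position G)) p :
  pass_or_move p.1 (cop_shadow_move p).
Proof.
rewrite /cop_shadow_move; case: ifP => // _.
by rewrite rook_pass_or_move eqxx orbT.
Qed.

Definition cop_shadow (c : G) : cop_strategy G :=
  CopStrategy c cop_shadow_legal.

Lemma cop_shadow_column c (r : robber_strategy G) i :
  uncaptured_at_turn (cop_shadow c) r i ->
  (robber_at (cop_shadow c) r i).2 = (robber_at (cop_shadow c) r 0).2.
Proof.
set s := cop_shadow c; elim: i => [//|i IHi] unc.
rewrite -IHi => [|j le_ji]; last by apply: unc; apply: leqW.
(* A robber on a line with the cop would be captured at the cop's next turn. *)
have far j : j <= i.+1 -> ~~ pass_or_move (cop_at s r j) (robber_at s r j).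
  move=> /unc[_]; rewrite cop_atS /= /cop_shadow_move /=.
  by case: ifP => //; rewrite eqxx.
(* In round [i.+1] the cop enters the row that the robber had in round [i]. The robber must
   therefore leave that row, and a move that changes the row keeps the column. *)
have := far _ (leqnn _); rewrite [cop_at _ _ _]cop_atS /= /cop_shadow_move /=.
rewrite (negPf (far _ (leqnSn _))) rook_pass_or_move negb_or /= => /andP[ne1 _].
by have := robber_step s r i; rewrite rook_pass_or_move (negPf ne1) => /eqP.
Qed.

Lemma damage_cop_shadow c r : damage (cop_shadow c) r <= m.
Proof.
set y := (robber_at (cop_shadow c) r 0).2.
apply: (@leq_trans #|[set (x, y) | x : 'I_m]|).
  apply/subset_leq_card/subsetP => v; rewrite inE => /asboolP[i [<- unc]].
  apply/imsetP; exists (robber_at (cop_shadow c) r i).1 => //.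
  by rewrite /y -(cop_shadow_column unc); case: (robber_at _ _ _).
by apply: leq_trans (leq_imset_card _ _) _; rewrite card_ord.
Qed.

(** * Lower bound: the robber who seeks unvisited safe cells *)

Definition safe (c v : G) : bool := (c.1 != v.1) && (c.2 != v.2).

Definition fresh_move (visited : seq G) (v c : G) : G :=
  odflt v [pick w | [&& pass_or_move v w, safe c w & w \notin visited]].

Lemma fresh_move_legal (h : seq (position G)) (p : position G) c :
  pass_or_move p.2 (fresh_move [seq q.2 | q <- rcons h p] p.2 c).
Proof.
rewrite /fresh_move; case: pickP => [w /and3P[]|] //= _.
exact: pass_or_move_refl.
Qed.

Definition robber_fresh (v : G) : robber_strategy G :=
  RobberStrategy (fun c => odflt v [pick w | safe c w]) fresh_move_legal.

Hypothesis hmn : 3 <= m <= n.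

(** The cell [v] is counted even if unsafe, since the robber has already visited it: if no counted
    cell is fresh, at least [m] cells have been visited. *)
Lemma card_available (v c : G) :
  v.1 != c.1 \/ v.2 != c.2 ->
  m <= #|[set w | (w == v) || pass_or_move v w && safe c w]|.
Proof.
case: v c => [x y] [a b] /= ne; set S := [set w | _].
have [eax|nax] := eqVneq a x; have [eby|nby] := eqVneq b y.
- by move: ne; rewrite eax eby !eqxx => -[].
- have cC : #|[set (x', y) | x' : 'I_m]| = m.
    by rewrite card_imset ?card_ord // => ? ? [].
  rewrite -[leqLHS]cC; apply/subset_leq_card/subsetP => _ /imsetP[x' _ ->].
  rewrite inE rook_pass_or_move /safe /= eax nby eqxx orbT andbT.
  by rewrite xpair_eqE eqxx andbT eq_sym orbN.
- apply: (@leq_trans n); first by case/andP: hmn.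
  have cC : #|[set (x, y') | y' : 'I_n]| = n.
    by rewrite card_imset ?card_ord // => ? ? [].
  rewrite -[leqLHS]cC; apply/subset_leq_card/subsetP => _ /imsetP[y' _ ->].
  rewrite inE rook_pass_or_move /safe /= eby nax eqxx.
  by rewrite xpair_eqE eqxx eq_sym orbN.
(* The column of [v] outside the cop's row gives only [m.-1] cells. One more is taken in the row of
   [v], off the columns [y] and [b], which is possible as [n >= 3]. *)
- have [y' /andP[ny'y ny'b]] : exists y' : 'I_n, (y' != y) && (y' != b).
    have : 0 < #|~: [set y; b]|.
      have := cardsC [set y; b]; rewrite card_ord cards2.
      by case/andP: hmn; case: (_ != _) => /=; lia.
    by case/card_gt0P => y'; rewrite !inE negb_or => ?; exists y'.
  pose C := [set (x', y) | x' in [set~ a]] : {set G}.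
  have cC : #|C| = m.-1 by rewrite card_imset ?cardsC1 ?card_ord // => ? ? [].
  have nC : (x, y') \notin C.
    by apply/negP => /imsetP[x' _ [_ e]]; rewrite e eqxx in ny'y.
  have cC1 : #|(x, y') |: C| = m.
    by rewrite cardsU1 nC cC; case/andP: hmn; lia.
  rewrite -[leqLHS]cC1; apply/subset_leq_card/subsetP => w.
  rewrite in_setU1 inE => /orP[/eqP->|].
    by rewrite rook_pass_or_move /safe /= nax [b == _]eq_sym ny'b eqxx !orbT.
  case/imsetP => x'; rewrite !inE => nx'a ->.
  by rewrite rook_pass_or_move /safe /= nby [a == _]eq_sym nx'a eqxx !orbT.
Qed.

Lemma fresh_moveP (visited : seq G) (c0 v c : G) :
  v \in visited -> size visited < m -> safe c0 v -> pass_or_move c0 c ->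
  safe c (fresh_move visited v c) && (fresh_move visited v c \notin visited).
Proof.
move=> vV ltVm /andP[ne1 ne2]; rewrite rook_pass_or_move => step.
rewrite /fresh_move; case: pickP => [w /and3P[_ -> ->] //|none].
suff : m <= size visited by rewrite leqNgt ltVm.
(* The cop shared no line with [v] and his step keeps one coordinate, so he has not landed on
   [v]. *)
have ne : v.1 != c.1 \/ v.2 != c.2.
  by case/orP: step => /eqP <-; [left|right]; rewrite eq_sym.
apply: leq_trans (card_available ne) (leq_trans _ (card_size visited)).
apply/subset_leq_card/subsetP => w; rewrite inE => /orP[/eqP-> //|/andP[vw cw]].
by have := none w; rewrite vw cw /= => /negbFE.
Qed.

Lemma robber_fresh_safe (s : cop_strategy G) v i :
  let r := robber_fresh v in
  i < m ->
  safe (cop_at s r i) (robber_at s r i) /\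
  uniq [seq robber_at s r j | j <- iota 0 i.+1].
Proof.
move=> r; elim: i => [_|i IHi lt_im].
  split=> //; rewrite /cop_at /robber_at /=; case: pickP => //= none.
  case: (cop_start s) none => [a b] none.
  have other k (a' : 'I_k) : 1 < k -> exists x, a' != x.
    move=> k1; have : 0 < #|[set~ a']| by rewrite cardsC1 card_ord; lia.
    by case/card_gt0P => x; rewrite !inE eq_sym; exists x.
  have [x ax] : exists x, a != x by apply: other; lia.
  have [y yb] : exists y, b != y by apply: other; lia.
  by have := none (x, y); rewrite /safe /= ax yb.
have [safe_i uniq_i] := IHi (ltnW lt_im).
rewrite -[i.+2]addn1 iotaD map_cat cats1 rcons_uniq uniq_i andbT add0n.
have eqV : [seq q.2 | q <- rcons (play s r i).1 (play s r i).2] =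
           [seq robber_at s r j | j <- iota 0 i.+1].
  by rewrite play_history -map_comp.
have -> : robber_at s r i.+1 =
    fresh_move [seq robber_at s r j | j <- iota 0 i.+1]
      (robber_at s r i) (cop_at s r i.+1).
  by rewrite robber_atS -eqV /= /cop_at /robber_at -surjective_pairing.
apply/andP; apply: fresh_moveP safe_i (cop_step s r i);
  last by rewrite size_map size_iota.
by apply: map_f; rewrite mem_iota leq0n add0n ltnSn.
Qed.

Lemma leq_damage_robber_fresh (s : cop_strategy G) v :
  m <= damage s (robber_fresh v).
Proof.
set r := robber_fresh v.
(* Rounds [0] to [m.-1] provide the [m] distinct cells. *)
have m_gt0 : m.-1 < m by lia.
have [_ uniq_r] := robber_fresh_safe s v m_gt0.
rewrite prednK in uniq_r; last by lia.
have <- : #|[seq robber_at s r j | j <- iota 0 m]| = m.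
  by rewrite (card_uniqP uniq_r) size_map size_iota.
apply/subset_leq_card/subsetP => _ /mapP[i + ->].
rewrite mem_iota add0n => lt_im.
rewrite inE; apply/asboolP; exists i; split=> // j le_ji.
have [/andP[ne1 ne2] _] := robber_fresh_safe s v (leq_ltn_trans le_ji lt_im).
split; first by apply: contraNneq ne1 => ->.
(* Sharing no line with the robber, the cop cannot reach him in one step; so the cell of round
   [m.-1] is damaged too. *)
have := cop_step s r j; rewrite rook_pass_or_move; apply: contraTneq => ->.
by rewrite (negPf ne1) (negPf ne2).
Qed.

End RookGraph.

Theorem theorem9 (m n : nat) (hmn : 3 <= m <= n) :
  dmg (cartesian_product (complete_graph m) (complete_graph n)) = m.
Proof.
have [m_gt0 n_gt0] : 0 < m /\ 0 < n by lia.
pose v : cartesian_product (complete_graph m) (complete_graph n) :=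
  (Ordinal m_gt0, Ordinal n_gt0).
apply/eqP; rewrite eqn_leq; apply/andP; split.
  apply: leq_trans (dmg_leq (cop_shadow v)) _.
  by apply: max_damage_leq => r; apply: damage_cop_shadow.
apply: leq_dmg => [|s]; first by rewrite card_prod !card_ord leq_pmulr.
apply: leq_trans (leq_damage_robber_fresh hmn s v) _.
exact: damage_le_max_damage.
Qed.
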